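(* Let $1\le p<n$ be integers, $C=[I_p\ \ 0]\in\mathbf{R}^{p\times n}$, $A\in\mathbf{R}^{n\times n}$, $x_0\in\mathbf{R}^n$. Consider the continuous-time linear system $$\Sigma^c:\quad \dot x(t)=Ax(t),\quad x(0)=x_0,\qquad y(t)=Cx(t).$$ Suppose that there are (known) vectors $\underline{x}_0,\overline{x}_0\in\mathbf{R}^n$ and matrices $\underline{A},\overline{A}\in\mathbf{R}^{n\times n}$ such that $0\le\underline{x}_0\le x_0\le\overline{x}_0$, $\underline{A}\le A\le\overline{A}$ and $\underline{A}$ is Metzler, and suppose that the state trajectory $x(t)$ of $\Sigma^c$ is bounded on $[0,\infty)$. Let $\omega_0^\ell,\omega_0^u\in\mathbf{R}^{n-p}$ with $\omega_0^\ell\ge 0$, $\omega_0^u\ge 0$. Let $L\in\mathbf{R}_+^{(n-p)\times p}$ be a nonnegative matrix and, with the block partitions given in the context, put $$\underline{\hat A}:=\underline{A}^{22}-L\overline{A}^{12},\quad \overline{\hat A}:=\overline{A}^{22}-L\underline{A}^{12},$$ $$\underline{G}:=\underline{\hat A}L+\underline{A}^{21}-L\overline{A}^{11},\quad \overline{G}:=\overline{\hat A}L+\overline{A}^{21}-L\underline{A}^{11},$$ $$\hat C:=\begin{bmatrix}0\\ I_{n-p}\end{bmatrix},\quad \hat D:=\begin{bmatrix}I_p\\ L\end{bmatrix}.$$ Suppose that $L$ satisfies: (i) $\underline{\hat A}$ is Metzler; (ii) $\underline{G}\ge 0$; (iii) $\overline{\hat A}$ is Hurwitz; (iv) $\omega_0^\ell\le\underline{x}_0^2-L\overline{x}_0^1$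 and $\overline{x}_0^2-L\underline{x}_0^1\le\omega_0^u$. Then $\omega_0^\ell\le\omega_0^u$, and the pair of $(n-p)$-dimensional systems $$\hat\Sigma^{cr\ell}:\quad \dot\omega^\ell(t)=\underline{\hat A}\omega^\ell(t)+\underline{G}y(t),\ \ \omega^\ell(0)=\omega_0^\ell,\qquad \hat x^\ell(t):=\hat C\omega^\ell(t)+\hat Dy(t),$$ $$\hat\Sigma^{cru}:\quad \dot\omega^u(t)=\overline{\hat A}\omega^u(t)+\overline{G}y(t),\ \ \omega^u(0)=\omega_0^u,\qquad \hat x^u(t):=\hat C\omega^u(t)+\hat Dy(t)$$ is an interval reduced-order positive observer for $\Sigma^c$, in the sense that $\xi(t):=\hat x^u(t)-\hat x^\ell(t)$ is bounded on $[0,\infty)$ and $$0\le\hat x^\ell(t)\le x(t)\le\hat x^u(t)\quad\text{for all } t\ge 0.$$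
   Context: All inequalities between vectors or matrices are elementwise: $M\ge N$ means $m_{ij}\ge n_{ij}$ for all $i,j$. $\mathbf{R}_+^{r\times s}$ is the set of $r\times s$ matrices with nonnegative entries. A square real matrix is Metzler if all its off-diagonal entries are nonnegative, and Hurwitz if all its eigenvalues have negative real part. Partitions: vectors in $\mathbf{R}^n$ are split as $\underline{x}_0=\begin{bmatrix}\underline{x}_0^1\\ \underline{x}_0^2\end{bmatrix}$, $\overline{x}_0=\begin{bmatrix}\overline{x}_0^1\\ \overline{x}_0^2\end{bmatrix}$ with $\underline{x}_0^1,\overline{x}_0^1\in\mathbf{R}^p$ and $\underline{x}_0^2,\overline{x}_0^2\in\mathbf{R}^{n-p}$; matrices are split conformally as $\underline{A}=\begin{bmatrix}\underline{A}^{11}&\underline{A}^{12}\\ \underline{A}^{21}&\underline{A}^{22}\end{bmatrix}$, $\overline{A}=\begin{bmatrix}\overline{A}^{11}&\overline{A}^{12}\\ \overline{A}^{21}&\overline{A}^{22}\end{bmatrix}$ with $\underline{A}^{11},\overline{A}^{11}\in\mathbf{R}^{p\times p}$. *)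

(* Defs.v *)
From HB Require Import structures.
From mathcomp Require Export all_boot all_order all_algebra.
From mathcomp Require Export all_classical all_reals all_analysis.
From mathcomp Require Import complex.

Set Implicit Arguments.
Unset Strict Implicit.
Unset Printing Implicit Defensive.

Import Order.TTheory GRing.Theory Num.Theory.
Import numFieldNormedType.Exports.

Local Open Scope classical_set_scope.
Local Open Scope ring_scope.

(* elementwise order; not to be confused with row-space inclusion (_ <= _)%MS *)
Definition lemx (R : realType) (m n : nat) (M N : 'M[R]_(m, n)) : Prop :=
  forall i j, M i j <= N i j.

Notation "M <=m N" := (lemx M N) (at level 70, no associativity) : ring_scope.

Definition Metzler (R : realType) (n : nat) (M : 'M[R]_n) : Prop :=
  forall i j, i != j -> 0 <= M i j.

Definition Hurwitz (R : realType) (n : nat) (M : 'M[R]_n) : Prop :=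
  forall z : R[i],
    eigenvalue (map_mx (real_complex R) M) z -> complex.Re z < 0.

(* x solves x'(t) = F(t, x(t)), x(0) = x0 on [0, +oo[. The values of x at
   negative times are irrelevant: at 0 only right-continuity is required, the
   one-sided equation at 0 then being automatic when F(t, x(t)) is continuous. *)
Definition ivp_solution (R : realType) (V : normedModType R)
    (F : R -> V -> V) (x0 : V) (x : R -> V) : Prop :=
  [/\ x 0 = x0,
      {within `[0, +oo[, continuous x}
    & forall t : R, 0 < t -> is_derive t 1 x (F t (x t))].

Definition bounded_traj (R : realType) (V : normedModType R)
    (x : R -> V) : Prop :=
  [bounded x t | t in `[0, +oo[].

Section Observer.
Variables (R : realType) (p q : nat).

Definition outC : 'M[R]_(p, p + q) := row_mx 1%:M 0.

Definition hatC : 'M[R]_(p + q, q) := col_mx 0 1%:M.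

Definition hatD (L : 'M[R]_(q, p)) : 'M[R]_(p + q, p) := col_mx 1%:M L.

(* M is the bound of A entering with a plus sign and N the one entering with a
   minus sign: the lower observer uses M = lower bound, N = upper bound, and
   the upper observer the converse. *)
Definition hatA (M N : 'M[R]_(p + q)) (L : 'M[R]_(q, p)) : 'M[R]_q :=
  drsubmx M - L *m ursubmx N.

Definition gainG (M N : 'M[R]_(p + q)) (L : 'M[R]_(q, p)) : 'M[R]_(q, p) :=
  hatA M N L *m L + dlsubmx M - L *m ulsubmx N.

Definition interval_reduced_order_positive_observer
    (Al Au : 'M[R]_q) (Gl Gu L : 'M[R]_(q, p)) (wl0 wu0 : 'cV[R]_q)
    (x : R -> 'cV[R]_(p + q)) : Prop :=
  let y t := outC *m x t in
  forall wl wu : R -> 'cV[R]_q,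
    ivp_solution (fun t w => Al *m w + Gl *m y t) wl0 wl ->
    ivp_solution (fun t w => Au *m w + Gu *m y t) wu0 wu ->
    let xl t := hatC *m wl t + hatD L *m y t in
    let xu t := hatC *m wu t + hatD L *m y t in
    bounded_traj (fun t => xu t - xl t) /\
    forall t : R, 0 <= t -> [/\ 0 <=m xl t, xl t <=m x t & x t <=m xu t].

End Observer.

(* Main.v *)
(* Write z := x^2 - L x^1, so that x = hatC z + hatD y and z solves
   z' = hatA z + G y, where hatA and G are built from the true A and lie between
   their lower and upper versions. The differences z - wl and wu - z then
   satisfy v' >= M v with M Metzler and v(0) >= 0, whence v >= 0: otherwise a
   coordinate of exp(-K t) v that is minimal over time and coordinates would
   have a positive derivative at its minimum. As 0 <= wl <= wu, the boundedness
   of wu - wl reduces to that of wu: the upper matrix M, being Metzler and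
   Hurwitz, has a positive vector v with M v < 0, and the comparison applied to
   B v - wu gives wu <= B v for large B. *)
Require Import Defs.
From mathcomp Require Import complex ring lra.

Set Implicit Arguments.
Unset Strict Implicit.
Unset Printing Implicit Defensive.
Import Order.TTheory GRing.Theory Num.Theory.
Import numFieldNormedType.Exports.
Local Open Scope classical_set_scope.
Local Open Scope ring_scope.

(** The right side does not depend on [i]: it serves as the damping rate in the comparison and as a
    large value of [s] in the resolvent argument. *)
Lemma row_sum_lt (R : realType) n (M : 'M[R]_n) i :
  \sum_j M i j < 1 + \sum_k \sum_j `|M k j|.
Proof.
rewrite [X in _ < 1 + X](bigD1 i) //= addrA ltr_wpDr ?sumr_ge0 //.
  by move=> k _; exact: sumr_ge0.
by rewrite addrC ltr_pwDr // ler_sum // => j _; exact: ler_norm.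
Qed.

(** * Trajectories and comparison for linear differential inequalities *)

Section Trajectories.
Variable R : realType.

(** Difference quotients with [h < 0] are nonpositive here, and the derivative is their limit. Using
    one side only covers a minimum at the right end of an interval. *)
Lemma derive_le0_left_min (f : R -> R) (a t df : R) : a < t ->
  (forall s, a <= s <= t -> f t <= f s) -> is_derive t 1 f df -> df <= 0.
Proof.
move=> lt_at fmin fdf.
have fdrv : derivable f t 1 by exact: ex_derive.
rewrite -(@derive_val _ _ _ _ _ f df) ['D_1 f t]cvg_at_leftE //.
apply: limr_le.
  rewrite -(cvg_at_leftE (fun h => h^-1 *: ((f \o shift t) _ - f t))) //.
  apply: cvg_trans fdrv; apply: cvg_app.
  move=> A [e egt0 Ae]; exists e => // x xe xgt0; apply: Ae => //.
  exact/ltr0_neq0.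
near=> h; rewrite /= [_%:A]mulr1.
have h0 : h < 0 by near: h; exists 1 => /=.
apply: mulr_le0_ge0; rewrite ?invr_le0 ?(ltW h0) // subr_ge0.
apply: fmin; rewrite -lerBlDr gerDr (ltW h0) andbT ltW //.
near: h; exists (t - a); first by rewrite /= subr_gt0.
by move=> h; rewrite /= sub0r normrN => /ltr_normlP[]; lra.
Unshelve. all: by end_near. Qed.

(* Coordinatewise form of "v is continuous on [0, +oo[ with derivative dv on
   ]0, +oo[", which spares the topology of matrices. *)
Definition traj_deriv n (v dv : R -> 'cV[R]_n) : Prop := forall i,
  {within `[0, +oo[, continuous (fun t : R => v t i 0)} /\
  forall t : R, 0 < t -> is_derive t 1 (fun s : R => v s i 0) (dv t i 0).

Lemma ivp_solution_traj_deriv n (F : R -> 'cV[R]_n -> 'cV[R]_n) v0 v :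
  ivp_solution F v0 v -> traj_deriv v (fun t : R => F t (v t)).
Proof.
move=> [_ cv dv] i; split=> [t|t t0].
  exact: (cvg_comp _ _ (cv t) (@coord_continuous _ _ _ i 0 (v t))).
have dvt := dv _ t0; have drv : derivable v t 1 by exact: ex_derive.
apply: DeriveDef; first exact: (derivable_mxP _ _ _).1 drv i 0.
by rewrite -(@derive_val _ _ _ _ _ v (F t (v t))) derive_mx // mxE.
Qed.

Lemma traj_deriv_cst n (c : 'cV[R]_n) : traj_deriv (cst c) (cst 0).
Proof.
move=> i; split=> [t|t _]; first exact: cst_continuous.
by rewrite /= mxE; exact: is_derive_cst.
Qed.

Lemma traj_derivB n (v w dv dw : R -> 'cV[R]_n) :
  traj_deriv v dv -> traj_deriv w dw ->
  traj_deriv (fun t : R => v t - w t) (fun t : R => dv t - dw t).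
Proof.
move=> hv hw i; have [cv dvi] := hv i; have [cw dwi] := hw i.
have -> : (fun t : R => (v t - w t) i 0) =
    (fun t : R => v t i 0) - (fun t : R => w t i 0).
  by apply/funext => t; rewrite !mxE.
split=> [t|t t0]; first by apply: continuousB; [exact: cv|exact: cw].
by rewrite !mxE; apply: is_deriveB; [exact: dvi|exact: dwi].
Qed.

Lemma traj_deriv_mulmx m n (N : 'M[R]_(m, n)) (v dv : R -> 'cV[R]_n) :
  traj_deriv v dv ->
  traj_deriv (fun t : R => N *m v t) (fun t : R => N *m dv t).
Proof.
move=> hv i.
have -> : (fun t : R => (N *m v t) i 0) =
    \sum_j (N i j *: (fun t : R => v t j 0)).
  by apply/funext => t; rewrite !mxE fct_sumE.
split=> [t|t t0].
  rewrite fct_sumE; move: t; apply: continuous_big => [|j _].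
    exact: add_continuous.
  by move=> t; apply: continuousZl_tmp; exact: (hv j).1.
rewrite mxE; apply: is_derive_sum => j.
by apply: is_deriveZ; exact: (hv j).2.
Qed.

Lemma metzler_comparison n (M : 'M[R]_n) (v dv : R -> 'cV[R]_n) :
  Metzler M -> traj_deriv v dv -> 0 <=m v 0 ->
  (forall t, 0 < t -> M *m v t <=m dv t) ->
  forall t, 0 <= t -> 0 <=m v t.
Proof.
move=> hM hv v0 hdv T T0.
(* [K] exceeds every row sum of [M]; a negative coordinate at time [T] is refuted on the compact
   interval from 0 to [T]. *)
pose K := 1 + \sum_i \sum_j `|M i j|.
pose E (t : R) := expR (- K * t).
pose u i t := E t * v t i 0.
have Egt0 t : 0 < E t by exact: expR_gt0.
have dE (t : R) : is_derive t 1 E (- K * E t).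
  rewrite /E; apply: is_derive_eq; rewrite /GRing.scale /=; ring.
have cE (t : R) : {for t, continuous E}.
  by apply/differentiable_continuous/derivable1_diffP; exact: ex_derive.
have cu i : {within `[0, T], continuous (u i)}.
  have sub : `[0, T]%classic `<=` `[0, +oo[%classic.
    by apply: subset_itvl; rewrite bnd_simp.
  apply: continuous_subspaceW sub _ => t.
  apply: continuousM; last exact: (hv i).1.
  by apply: continuous_subspaceT.
have du i (t : R) :
    0 < t -> is_derive t 1 (u i) (E t * (dv t i 0 - K * v t i 0)).
  move=> t0; have dvi := (hv i).2 _ t0.
  rewrite /u; apply: is_derive_eq; rewrite /GRing.scale /=; ring.
have tm i := EVT_min T0 (cu i).
pose tau i := s2val (cid2 (tm i)).
have tauT i : tau i \in `[0, T] by rewrite /tau; case: cid2.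
have tau_min i t : t \in `[0, T] -> u i (tau i) <= u i t.
  by rewrite /tau; case: cid2 => s _ /= h /h.
move=> k j; rewrite [j]ord1 mxE leNgt; apply/negP => vk_lt0.
case: (@arg_minP _ _ _ k predT (fun i => u i (tau i))) => // i _ imin.
set s := tau i in imin.
have TT : T \in `[0, T] by rewrite in_itv /= T0 lexx.
have ui_lt0 : u i s < 0.
  apply: le_lt_trans (imin k isT) _; apply: le_lt_trans (tau_min k _ TT) _.
  by rewrite pmulr_rlt0.
have vi_lt0 : v s i 0 < 0 by rewrite pmulr_rlt0 in ui_lt0.
have /andP[s0 sT] : 0 <= s <= T by have := tauT i; rewrite in_itv.
(* A minimum at time 0 is excluded by the initial condition; a minimum at [T] is allowed. *)
have {}s0 : 0 < s.
  rewrite lt_neqAle s0 andbT; apply/eqP => s0'.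
  by move: vi_lt0; rewrite -s0' ltNge; have := v0 i 0; rewrite mxE => ->.
suff : 0 < E s * (dv s i 0 - K * v s i 0).
  apply/negP; rewrite -leNgt; apply: (derive_le0_left_min s0 _ (du i s s0)).
  move=> t /andP[t0 ts]; apply: tau_min; rewrite in_itv /= t0.
  exact: le_trans ts sT.
(* Off-diagonal entries are nonnegative and coordinate [i] is minimal, so [(M v)_i >= r v_i] with
   [r] the row sum; [r < K] and [v_i < 0] give [r v_i > K v_i]. *)
rewrite pmulr_rgt0 // subr_gt0; apply: lt_le_trans (hdv s s0 i 0).
have vmin l : v s i 0 <= v s l 0.
  rewrite -(ler_pM2l (Egt0 s)); apply: le_trans (imin l isT) _.
  by apply: tau_min; rewrite in_itv /= ltW.
rewrite mxE; apply: (@lt_le_trans _ _ ((\sum_l M i l) * v s i 0)).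
  by rewrite ltr_nM2r // row_sum_lt.
rewrite mulr_suml ler_sum // => l _.
have [->//|il] := eqVneq i l.
by apply: ler_wpM2l; [exact: hM|exact: vmin].
Qed.

End Trajectories.

(** * Positive vectors for Metzler Hurwitz matrices *)

Section MetzlerHurwitz.
Variable R : realType.

Lemma Hurwitz_no_nonneg_eigenvalue n (M : 'M[R]_n) (s : R) :
  Hurwitz M -> 0 <= s -> (char_poly M).[s] != 0.
Proof.
move=> hM s0; apply/negP => /eqP ps0.
have : eigenvalue (map_mx (real_complex R) M) (real_complex R s).
  rewrite eigenvalue_root_char -map_char_poly.
  by rewrite fmorph_root; apply/rootP.
by move/hM; rewrite /= ltNge s0.
Qed.

(* If v solves (s - M) v = c 1 with c > 0, then its minimal coordinate m
   satisfies c <= m (s - r), where r is the corresponding row sum of M. *)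
Lemma metzler_resolvent_gt0 n (M : 'M[R]_n) (s c : R) (v : 'I_n -> R) :
  Metzler M -> 0 < c -> (forall i, \sum_j M i j < s) ->
  (forall i, s * v i - \sum_j M i j * v j = c) -> forall i, 0 < v i.
Proof.
move=> hM c0 rs hv k.
case: (@arg_minP _ _ _ k predT v) => // i _ imin.
apply: lt_le_trans (imin k isT).
have : c <= (s - \sum_j M i j) * v i.
  rewrite -(hv i) mulrBl lerB // mulr_suml ler_sum // => j _.
  have [->//|ij] := eqVneq i j.
  by apply: ler_wpM2l; [exact: hM|exact: imin].
move=> /(lt_le_trans c0); rewrite pmulr_rgt0 // subr_gt0; exact: rs.
Qed.

(* v = det(s - M) adj(s - M) 1 is polynomial in s and solves
   (s - M) v = det(s - M)^2 1, with det(s - M) <> 0 for s >= 0. It is positive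
   for large s. Were it not at 0, some s >= 0 would have min_i v_i = 0, and the
   equation of the vanishing coordinate would read 0 < det(s - M)^2 <= 0. *)
Lemma metzler_hurwitz_certificate n (M : 'M[R]_n) :
  Metzler M -> Hurwitz M ->
  exists v : 'cV[R]_n,
    (forall i, 0 < v i 0) /\ exists2 c, 0 < c & M *m v = const_mx (- c).
Proof.
move=> hM hH.
pose chi := char_poly M.
pose q i : {poly R} := chi * (\adj (char_poly_mx M) *m const_mx 1) i (0 : 'I_1).
have eq_poly i : 'X * q i - \sum_j (M i j)%:P * q j = chi ^+ 2.
  have : (char_poly_mx M *m (\adj (char_poly_mx M) *m const_mx 1)) i (0 : 'I_1)
      = chi.
    by rewrite mulmxA mul_mx_adj mul_scalar_mx !mxE mulr1.
  (* Row [i] of [(X - M) adj(X - M) 1 = chi 1] is multiplied by [chi]. *)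
  rewrite [in LHS]mxE => E; rewrite expr2 -[X in _ = _ * X]E mulr_sumr.
  rewrite [in RHS](eq_bigr (fun j =>
    ('X *+ (i == j)) * q j - (M i j)%:P * q j)).
    rewrite sumrB; congr (_ - _); rewrite (bigD1 i) //= eqxx.
    rewrite big1 ?addr0 // => j /negPf ji.
    by rewrite eq_sym ji mul0r.
  by move=> j _; rewrite -mulrBl /q mulrCA; congr (_ * _); rewrite !mxE.
clearbody q.
have eq_s s i : s * (q i).[s] - \sum_j M i j * (q j).[s] = chi.[s] ^+ 2.
  rewrite -horner_exp -(eq_poly i) hornerD hornerN hornerM hornerX horner_sum.
  by congr (_ - _); apply: eq_bigr => j _; rewrite hornerM hornerC.
have chi2_gt0 s : 0 <= s -> 0 < chi.[s] ^+ 2.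
  by move=> s0; rewrite exprn_even_gt0 //= Hurwitz_no_nonneg_eigenvalue.
exists (\col_i (q i).[0]); split; last first.
  exists (chi.[0] ^+ 2); first exact: chi2_gt0.
  apply/colP => i; rewrite !mxE -(eq_s 0 i) mul0r sub0r opprK.
  by apply: eq_bigr => j _; rewrite mxE.
pose B := 1 + \sum_i \sum_j `|M i j|.
have B0 : 0 <= B.
  by rewrite addr_ge0 // sumr_ge0 // => i _; exact: sumr_ge0.
have qB := metzler_resolvent_gt0 hM (chi2_gt0 B B0) (row_sum_lt M) (eq_s B).
move=> k; rewrite mxE ltNge; apply/negP => qk0.
(* The default 1 is harmless: [f] is positive when all coordinates are, and where [f] vanishes some
   coordinate does. *)
pose f s := \big[Order.min/1]_i (q i).[s].
have f_le s i : f s <= (q i).[s] by exact: bigmin_le.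
have [s [s0 fs0 [i qi0]]] :
    exists s, [/\ 0 <= s, 0 <= f s & exists i, (q i).[s] = 0].
  have cf : continuous f.
    apply: continuous_big => [|j _]; first exact: (@min_continuous _ R).
    exact: continuous_horner.
  have fB : 0 < f B by apply: lt_bigmin.
  have f0 : f 0 <= 0 by exact: le_trans (f_le 0 k) qk0.
  have [|s sB fs] := IVT (v := 0) B0 (continuous_subspaceT (A := _) cf).
    by rewrite ge_min f0 /= le_max (ltW fB) orbT.
  exists s; split; [by rewrite in_itv /= in sB; case/andP: sB|by rewrite fs|].
  have [i _ Ei] : exists2 i, true & (q i).[s] = 0; last by exists i.
  move: fs; rewrite /f; elim/big_ind: _ => [/eqP|x y hx hy|i _ ?].
  - by rewrite oner_eq0.
  - by rewrite minEle; case: ifP.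
  - by exists i.
have := eq_s s i; rewrite qi0 mulr0 sub0r => E.
have := chi2_gt0 s s0; rewrite -E oppr_gt0 ltNge => /negP[].
apply: sumr_ge0 => j _.
have [<-|ij] := eqVneq i j; first by rewrite qi0 mulr0.
by rewrite mulr_ge0 ?hM // (le_trans fs0).
Qed.

End MetzlerHurwitz.

(** * Elementwise order and boundedness of trajectories *)

Section ElementwiseOrder.
Variable R : realType.

Lemma lemxx m n (M : 'M[R]_(m, n)) : M <=m M.
Proof. by move=> i j. Qed.

Lemma lemx_trans m n (N M P : 'M[R]_(m, n)) : M <=m N -> N <=m P -> M <=m P.
Proof. by move=> MN NP i j; exact: le_trans (MN i j) (NP i j). Qed.

Lemma lemxD m n (M N M' N' : 'M[R]_(m, n)) :
  M <=m M' -> N <=m N' -> M + N <=m M' + N'.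
Proof. by move=> hM hN i j; rewrite !mxE lerD. Qed.

Lemma lemxB m n (M N M' N' : 'M[R]_(m, n)) :
  M <=m M' -> N' <=m N -> M - N <=m M' - N'.
Proof. by move=> hM hN i j; rewrite !mxE lerB. Qed.

Lemma lemx_subr_ge0 m n (M N : 'M[R]_(m, n)) : 0 <=m N - M <-> M <=m N.
Proof.
by split=> h i j; have := h i j; rewrite !mxE subr_ge0.
Qed.

Lemma lemx_mull m n p (L : 'M[R]_(m, n)) (M N : 'M[R]_(n, p)) :
  0 <=m L -> M <=m N -> L *m M <=m L *m N.
Proof.
move=> hL MN i j; rewrite !mxE ler_sum // => k _; apply: ler_wpM2l (MN k j).
by have := hL i k; rewrite mxE.
Qed.

Lemma lemx_mulr m n p (M N : 'M[R]_(m, n)) (P : 'M[R]_(n, p)) :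
  0 <=m P -> M <=m N -> M *m P <=m N *m P.
Proof.
move=> hP MN i j; rewrite !mxE ler_sum // => k _; apply: ler_wpM2r (MN i k).
by have := hP k j; rewrite mxE.
Qed.

Lemma lemx_col_mx m1 m2 n (M M' : 'M[R]_(m1, n)) (N N' : 'M[R]_(m2, n)) :
  M <=m M' -> N <=m N' -> col_mx M N <=m col_mx M' N'.
Proof.
move=> hM hN i j.
by case: (split_ordP i) => k ->; rewrite ?col_mxEu ?col_mxEd.
Qed.

Lemma lemx_usubmx m1 m2 n (M N : 'M[R]_(m1 + m2, n)) :
  M <=m N -> usubmx M <=m usubmx N.
Proof. by move=> MN i j; rewrite !mxE. Qed.

Lemma lemx_dsubmx m1 m2 n (M N : 'M[R]_(m1 + m2, n)) :
  M <=m N -> dsubmx M <=m dsubmx N.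
Proof. by move=> MN i j; rewrite !mxE. Qed.

Lemma Metzler_le n (M N : 'M[R]_n) : Metzler M -> M <=m N -> Metzler N.
Proof. by move=> hM MN i j /hM Mij; exact: le_trans Mij (MN i j). Qed.

Lemma bounded_trajP n (f : R -> 'cV[R]_n) :
  bounded_traj f <->
  exists c, forall (t : R) i, 0 <= t -> `|f t i 0| <= c.
Proof.
split=> [[c [_ hc]]|[c hc]].
  (* The norm is bounded by every number above [c], not by [c] itself. *)
  exists (c + 1) => t i t0.
  have /(hc (c + 1)) : c < c + 1 by rewrite ltrDl.
  move=> /(_ t); rewrite /= in_itv /= t0 => /(_ isT); apply: le_trans.
  by rewrite [leRHS]/Num.Def.normr /= mx_normrE; exact: (le_bigmax _ _ (i, 0)).
(* For empty vectors [c] may be negative while the norm is 0. *)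
exists `|c|; split; first exact: num_real.
move=> d cd t; rewrite /= in_itv /= andbT => t0.
rewrite /Num.Def.normr /= mx_normrE bigmax_le => [//||[i j] _].
  exact: le_trans (normr_ge0 c) (ltW cd).
rewrite /= [j]ord1; apply: le_trans (hc t i t0) _.
exact: le_trans (ler_norm c) (ltW cd).
Qed.

End ElementwiseOrder.

Lemma metzler_hurwitz_upper_bound (R : realType) n (M : 'M[R]_n)
    (w g : R -> 'cV[R]_n) (k : R) :
  Metzler M -> Hurwitz M -> traj_deriv w (fun t => M *m w t + g t) ->
  (forall (t : R) i, 0 < t -> g t i 0 <= k) ->
  exists b : 'cV[R]_n, forall t : R, 0 <= t -> w t <=m b.
Proof.
move=> hM hH hw hg.
have [v [v0 [c c0 hv]]] := metzler_hurwitz_certificate hM hH.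
(* The first term makes [B c] dominate the forcing bound [k], the second makes [B v] dominate [w 0]:
   [B v] is a constant supersolution. *)
pose B := `|k| / c + \sum_i `|w 0 i 0| / v i 0.
have term_ge0 i : 0 <= `|w 0 i 0| / v i 0 by rewrite divr_ge0 // ltW.
exists (B *: v) => t t0; apply/lemx_subr_ge0; move: t t0.
apply: metzler_comparison hM (traj_derivB (traj_deriv_cst _) hw) _ _.
  apply/lemx_subr_ge0 => i j; rewrite [j]ord1 mxE -ler_pdivrMr //.
  apply: (@le_trans _ _ (`|w 0 i 0| / v i 0)).
    by rewrite ler_pM2r ?invr_gt0 // ler_norm.
  rewrite /B (bigD1 i) //= addrCA lerDl addr_ge0 ?sumr_ge0 //.
  by rewrite divr_ge0 // ltW.
move=> t t0; rewrite /= sub0r opprD mulmxBr addrC.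
apply: lemxD => [|i j]; first exact: lemxx.
rewrite -scalemxAr hv [j]ord1 !mxE mulrN lerN2.
apply: le_trans (hg t i t0) _; apply: le_trans (ler_norm k) _.
rewrite /B mulrDl divfK ?gt_eqF // lerDl mulr_ge0 ?(ltW c0) //.
exact: sumr_ge0.
Qed.

(** * Algebra of the reduced state *)

Section Observer.
Variables (R : realType) (p q : nat).
Implicit Types (M N : 'M[R]_(p + q)) (L : 'M[R]_(q, p)) (v : 'cV[R]_(p + q)).

Lemma outC_mulmx v : outC R p q *m v = usubmx v.
Proof.
by rewrite -{1}[v]vsubmxK /outC mul_row_col mul1mx mul0mx addr0.
Qed.

Lemma lemx_hatA M N M' N' L : 0 <=m L -> M <=m M' -> N' <=m N ->
  hatA M N L <=m hatA M' N' L.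
Proof.
move=> hL hM hN; apply: lemxB; first by move=> i j; rewrite !mxE.
by apply: lemx_mull => // i j; rewrite !mxE.
Qed.

Lemma lemx_gainG M N M' N' L : 0 <=m L -> M <=m M' -> N' <=m N ->
  gainG M N L <=m gainG M' N' L.
Proof.
move=> hL hM hN; apply: lemxB; last first.
  by apply: lemx_mull => // i j; rewrite !mxE.
apply: lemxD; last by move=> i j; rewrite !mxE.
by apply: lemx_mulr => //; exact: lemx_hatA.
Qed.

(** The observer states bracket this quantity; adding [L] times the output recovers the unmeasured
    block. *)
Definition reduced_state L v : 'cV[R]_q := dsubmx v - L *m usubmx v.

(** As a fixed linear image of the state, it inherits differentiability from the trajectory. *)
Lemma reduced_stateE L v : reduced_state L v = row_mx (- L) 1%:M *m v.
Proof.
by rewrite -{2}[v]vsubmxK mul_row_col mul1mx mulNmx addrC.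
Qed.

(** Substitute [x^2 = z + L x^1] in the two block rows; the extra term [hatA L x^1] is what the gain
    absorbs. *)
Lemma reduced_state_mulmx M L v :
  reduced_state L (M *m v) =
  hatA M M L *m reduced_state L v + gainG M M L *m usubmx v.
Proof.
rewrite /reduced_state -{1 2}[M]submxK -{1 2}[v]vsubmxK.
rewrite mul_block_col col_mxKu col_mxKd mulmxBr /gainG.
rewrite [X in _ = _ + X]mulmxDl [(_ + dlsubmx M) *m _]mulmxDl.
rewrite -(mulmxA (hatA _ _ _)) {1}/hatA mulmxBl mulmxDr mulNmx -!(mulmxA L).
move: (dlsubmx M *m _) (drsubmx M *m _) (L *m (ulsubmx M *m _)).
move: (L *m (ursubmx M *m _)) (hatA M M L *m _) => a b c d e.
apply/matrixP => i j; rewrite !mxE; ring.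
Qed.

(** The measured block is reproduced exactly, so estimates differ only in the lower block. *)
Lemma observer_stateE L v (w : 'cV[R]_q) :
  hatC R p q *m w + hatD L *m usubmx v =
  col_mx (usubmx v) (w + L *m usubmx v).
Proof. by rewrite /hatC /hatD !mul_col_mx mul0mx !mul1mx add_col_mx add0r. Qed.

End Observer.

(** * Order and boundedness of the interval estimates *)

Theorem corollary1 (R : realType) (n p : nat) (hp : (1 <= p)%N) (hpn : (p < n)%N)
  (A : 'M[R]_(p + (n - p))) (x0 : 'cV[R]_(p + (n - p)))
  (x : R -> 'cV[R]_(p + (n - p)))
  (hx : ivp_solution (fun _ v => A *m v) x0 x)
  (xl0 xu0 : 'cV[R]_(p + (n - p))) (Al Au : 'M[R]_(p + (n - p)))
  (hxl0 : 0 <=m xl0) (hx0l : xl0 <=m x0) (hx0u : x0 <=m xu0)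
  (hAl : Al <=m A) (hAu : A <=m Au) (hMetzler : Metzler Al)
  (hbounded : bounded_traj x)
  (wl0 wu0 : 'cV[R]_(n - p)) (hwl0 : 0 <=m wl0) (hwu0 : 0 <=m wu0)
  (L : 'M[R]_(n - p, p)) (hL : 0 <=m L)
  (h_i : Metzler (hatA Al Au L))
  (h_ii : 0 <=m gainG Al Au L)
  (h_iii : Hurwitz (hatA Au Al L))
  (h_ivl : wl0 <=m dsubmx xl0 - L *m usubmx xu0)
  (h_ivu : dsubmx xu0 - L *m usubmx xl0 <=m wu0) :
  wl0 <=m wu0 /\
  interval_reduced_order_positive_observer
    (hatA Al Au L) (hatA Au Al L) (gainG Al Au L) (gainG Au Al L) L wl0 wu0 x.
Proof.
(* As [L >= 0], the bounds on [x0] enter crosswise: a lower bound of [x^2] goes with an upper bound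
   of [x^1]. *)
have wl0_z0 : wl0 <=m reduced_state L x0.
  apply: lemx_trans h_ivl _; apply: lemxB; first exact: lemx_dsubmx.
  by apply: lemx_mull hL _; exact: lemx_usubmx.
have z0_wu0 : reduced_state L x0 <=m wu0.
  apply: lemx_trans h_ivu; apply: lemxB; first exact: lemx_dsubmx.
  by apply: lemx_mull hL _; exact: lemx_usubmx.
split; first exact: lemx_trans z0_wu0.
move=> wl wu hwl hwu.
pose y t := outC R p (n - p) *m x t.
pose xl t := hatC R p (n - p) *m wl t + hatD L *m y t.
pose xu t := hatC R p (n - p) *m wu t + hatD L *m y t.
change (bounded_traj (fun t => xu t - xl t) /\
  forall t, 0 <= t -> [/\ 0 <=m xl t, xl t <=m x t & x t <=m xu t]).
have [x_0 _ _] := hx; have [wl_0 _ _] := hwl; have [wu_0 _ _] := hwu.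
have tx := ivp_solution_traj_deriv hx.
have twl : traj_deriv wl (fun t => hatA Al Au L *m wl t + gainG Al Au L *m y t).
  exact: ivp_solution_traj_deriv hwl.
have twu : traj_deriv wu (fun t => hatA Au Al L *m wu t + gainG Au Al L *m y t).
  exact: ivp_solution_traj_deriv hwu.
have yE t : y t = usubmx (x t) by exact: outC_mulmx.
pose z t := reduced_state L (x t).
have tz : traj_deriv z (fun t => hatA A A L *m z t + gainG A A L *m y t).
  have -> : z = fun t => row_mx (- L) 1%:M *m x t.
    by apply/funext => t; rewrite -reduced_stateE.
  have := traj_deriv_mulmx (row_mx (- L) 1%:M) tx.
  congr traj_deriv; apply/funext => t.
  by rewrite -!reduced_stateE reduced_state_mulmx yE.
have x_ge0 t : 0 <= t -> 0 <=m x t.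
  move: t; apply: metzler_comparison (Metzler_le hMetzler hAl) tx _ _.
    by rewrite x_0; exact: lemx_trans hx0l.
  by move=> t _; exact: lemxx.
have y_ge0 t : 0 <= t -> 0 <=m y t.
  by move=> t0; rewrite yE => i j; have := x_ge0 t t0 (lshift _ i) j; rewrite !mxE.
have hatAlA : hatA Al Au L <=m hatA A A L by exact: lemx_hatA.
have hatAAu : hatA A A L <=m hatA Au Al L by exact: lemx_hatA.
have gainlA : gainG Al Au L <=m gainG A A L by exact: lemx_gainG.
have gainAu : gainG A A L <=m gainG Au Al L by exact: lemx_gainG.
have MA := Metzler_le h_i hatAlA; have MAu := Metzler_le MA hatAAu.
have gy_ge0 G t : 0 <=m G -> 0 < t -> 0 <=m G *m y t.
  move=> G0 t0; rewrite -(mul0mx _ (y t)); apply: lemx_mulr => //.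
  exact/y_ge0/ltW.
have z_ge0 t : 0 <= t -> 0 <=m z t.
  move: t; apply: metzler_comparison MA tz _ _.
    by rewrite /z x_0; exact: lemx_trans wl0_z0.
  move=> t t0; rewrite -[X in X <=m _]addr0.
  by apply: lemxD; [exact: lemxx|apply: gy_ge0 t0; exact: lemx_trans gainlA].
have wl_ge0 t : 0 <= t -> 0 <=m wl t.
  move: t; apply: metzler_comparison h_i twl _ _; first by rewrite wl_0.
  move=> t t0; rewrite -[X in X <=m _]addr0.
  by apply: lemxD; [exact: lemxx|exact: gy_ge0].
have wl_z t : 0 <= t -> wl t <=m z t.
  move=> t0; apply/lemx_subr_ge0; move: t t0.
  apply: metzler_comparison h_i (traj_derivB tz twl) _ _.
    by rewrite wl_0 /z x_0; exact/lemx_subr_ge0.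
  (* The defect is [(hatA A A L - hatA Al Au L) z + (gainG A A L - gainG Al Au L) y], nonnegative
     because [z] and [y] are. *)
  move=> t t0; rewrite mulmxBr opprD addrACA -[X in X <=m _]addr0.
  apply: lemxD.
    by apply: lemxB (lemxx _); apply: lemx_mulr => //; exact/z_ge0/ltW.
  by apply/lemx_subr_ge0; apply: lemx_mulr => //; exact/y_ge0/ltW.
have z_wu t : 0 <= t -> z t <=m wu t.
  move=> t0; apply/lemx_subr_ge0; move: t t0.
  apply: metzler_comparison MAu (traj_derivB twu tz) _ _.
    by rewrite wu_0 /z x_0; exact/lemx_subr_ge0.
  (* Comparing with the upper matrix leaves [hatA Au Al L - hatA A A L] acting on [z], whose sign is
     known. *)
  move=> t t0; rewrite mulmxBr opprD addrACA -[X in X <=m _]addr0.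
  apply: lemxD.
    by apply: lemxB (lemxx _) _; apply: lemx_mulr => //; exact/z_ge0/ltW.
  by apply/lemx_subr_ge0; apply: lemx_mulr => //; exact/y_ge0/ltW.
have xlE t : xl t = col_mx (y t) (wl t + L *m y t).
  by rewrite /xl yE observer_stateE.
have xuE t : xu t = col_mx (y t) (wu t + L *m y t).
  by rewrite /xu yE observer_stateE.
have xE t : x t = col_mx (y t) (z t + L *m y t).
  by rewrite yE /z /reduced_state subrK vsubmxK.
split; last first.
  move=> t t0; split.
  - have wly_ge0 : 0 <=m wl t + L *m y t.
      rewrite -[X in X <=m _]addr0; apply: lemxD; first exact: wl_ge0.
      by rewrite -(mulmx0 _ L); apply: lemx_mull => //; exact: y_ge0.
    rewrite xlE -[X in X <=m _]col_mx0.
    by apply: lemx_col_mx => //; exact: y_ge0.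
  - rewrite xlE xE; apply: lemx_col_mx => //.
    by apply: lemxD (lemxx _); exact: wl_z.
  - rewrite xuE xE; apply: lemx_col_mx => //.
    by apply: lemxD (lemxx _); exact: z_wu.
have [c hc] := (bounded_trajP x).1 hbounded.
have [b hb] : exists b : 'cV[R]_(n - p), forall t : R, 0 <= t -> wu t <=m b.
  (* Summing over all rows gives one bound on the forcing [G y] for every coordinate. *)
  pose k := \sum_i \sum_j `|gainG Au Al L i j| * `|c|.
  apply: (metzler_hurwitz_upper_bound (k := k) MAu h_iii twu) => t i t0.
  apply: (@le_trans _ _ (\sum_j `|gainG Au Al L i j| * `|c|)).
    rewrite mxE ler_sum // => j _; apply: le_trans (ler_norm _) _.
    rewrite normrM ler_wpM2l // yE mxE.
    by apply: le_trans (hc t _ (ltW t0)) (ler_norm c).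
  rewrite /k [leRHS](bigD1 i) //= lerDl sumr_ge0 // => l _.
  by rewrite sumr_ge0 // => j _; rewrite mulr_ge0.
apply/bounded_trajP; exists (\sum_i `|b i 0|) => t i t0.
(* The output terms cancel, leaving [wu - wl] with [0 <= wl <= wu <= b]. *)
rewrite xlE xuE opp_col_mx add_col_mx subrr opprD addrACA subrr addr0.
case: (split_ordP i) => k ->; rewrite ?col_mxEu ?col_mxEd.
  by rewrite mxE normr0 sumr_ge0.
have wlk : 0 <= wl t k 0 by have := wl_ge0 t t0 k 0; rewrite mxE.
have wlu : wl t k 0 <= wu t k 0.
  exact: le_trans (wl_z t t0 k 0) (z_wu t t0 k 0).
rewrite !mxE ger0_norm ?subr_ge0 //.
apply: (@le_trans _ _ `|b k 0|).
  rewrite lerBlDr (le_trans (hb t t0 k 0)) //.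
  by rewrite (le_trans (ler_norm _)) // lerDl.
by rewrite (bigD1 k) //= lerDl sumr_ge0.
Qed.
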